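(* Let $q\geq 2$ and $n>1$ be integers, $\mathbb{F}=\{1,-1\}$, and let $A\in M_q(\mathbb{F})$. For $k\in\{0,1,\ldots,q-1\}$ let $\mathcal{S}_k$ denote the sequency of the $k$-th column of $A$ and let $p_k=\frac12|A_{0,k}-A_{q-1,k}|$. For $k_0,k_1,\ldots,k_{n-1}\in\{0,1,\ldots,q-1\}$, let $\mathcal{S}_{k_{n-1}\ldots k_1k_0}$ denote the sequency of the column of $A^{\otimes n}$ with index $q^{n-1}k_{n-1}+\cdots+qk_1+k_0$. Then $$\mathcal{S}_{k_{n-1}\ldots k_1k_0}=\sum_{r=0}^{n-1}(-1)^{\sum_{m=0}^{r-1}p_{k_m}}\left(q^{n-1-r}\,\mathcal{S}_{k_r}+(q^{n-1-r}-1)\,p_{k_r}\right),$$ where the expression $\sum_{m=0}^{r-1}p_{k_m}$ is treated as $0$ for $r=0$.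
   Context: $M_q(\mathbb{F})$ is the set of $q\times q$ matrices with entries in $\mathbb{F}=\{1,-1\}$; rows and columns are indexed starting from $0$. The sequency of $v=[v_0\ v_1\ \cdots\ v_{N-1}]^T\in\mathbb{F}^N$ is $\mathcal{S}_v=\frac12\sum_{k=0}^{N-2}|v_k-v_{k+1}|$ (the number of sign changes). $\otimes$ is the Kronecker product: for $X\in M_{q_1}(\mathbb{F})$, $Y\in M_{q_0}(\mathbb{F})$, $(X\otimes Y)_{q_0i_1+i_0,\;q_0k_1+k_0}=X_{i_1,k_1}Y_{i_0,k_0}$, and $A^{\otimes n}$ is the $n$-fold Kronecker power; thus $(A^{\otimes n})_{i,k}=\prod_{r=0}^{n-1}A_{i_r,k_r}$ where $i=\sum_r q^r i_r$ and $k=\sum_r q^rk_r$ in base $q$. *)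

(* Defs.v *)
From HB Require Import structures.
From mathcomp Require Import all_boot all_order all_algebra.
From mathcomp Require Export mxtens.

Set Implicit Arguments.
Unset Strict Implicit.
Unset Printing Implicit Defensive.

Import Order.TTheory GRing.Theory Num.Theory.
Local Open Scope ring_scope.

Definition signF : {pred int} := [pred x | (x == 1) || (x == -1)].

(* Natural-number valued: the halving is exact on vectors over signF, see
   [sequencyE]. *)
Definition sequency (N : nat) (v : 'cV[int]_N) : nat :=
  (\sum_(i < N) \sum_(j < N | j == i.+1 :> nat) `|(v i 0 - v j 0)%R|)./2.

Definition first_ord (q : nat) (hq : (1 < q)%N) : 'I_q := Ordinal (ltnW hq).
Definition last_ord (q : nat) (hq : (1 < q)%N) : 'I_q := rev_ord (first_ord hq).

(* Half the distance between the first and last entries, i.e. [p_k] when [v] is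
   the [k]-th column of the matrix; exact over signF, see [parityE]. *)
Definition parity (q : nat) (hq : (1 < q)%N) (v : 'cV[int]_q) : nat :=
  `|(v (first_ord hq) 0 - v (last_ord hq) 0)%R|%N./2.

Lemma digits_index_proof (q n : nat) (k : 'I_n -> 'I_q) :
  (\sum_(r < n) q ^ r * k r < q ^ n)%N.
Proof.
elim: n k => [|n IHn] k; first by rewrite big_ord0 expn0.
rewrite big_ord_recr /= expnS.
have lt_k := ltn_ord (k ord_max).
apply: (@leq_trans (q ^ n + q ^ n * k ord_max)%N).
  by rewrite ltn_add2r; apply: (IHn (fun r => k (widen_ord (leqnSn n) r))).
by rewrite -mulnS mulnC leq_mul2r lt_k orbT.
Qed.

(* [k r] is the digit of weight [q ^ r]. *)
Definition digits_index (q n : nat) (k : 'I_n -> 'I_q) : 'I_(q ^ n) :=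
  Ordinal (digits_index_proof k).

Lemma signF_dist (x y : int) : x \in signF -> y \in signF ->
  `|(x - y)%R|%N = (x != y).*2.
Proof. by rewrite !inE => /orP[]/eqP-> /orP[]/eqP->. Qed.

Lemma signF_half (x y : int) : x \in signF -> y \in signF ->
  (`|(x - y)%R|./2.*2 = `|(x - y)%R|)%N.
Proof. by move=> Fx Fy; rewrite signF_dist // doubleK. Qed.

Lemma half_ratE (m : nat) : m./2.*2 = m -> (m./2)%:R = 2^-1 * m%:R :> rat.
Proof. by move=> {2}<-; rewrite -mul2n natrM mulKf. Qed.

Lemma sequencyE (N : nat) (v : 'cV[int]_N) : v \is a mxOver signF ->
  (sequency v)%:R =
    2^-1 * \sum_(i < N) \sum_(j < N | j == i.+1 :> nat) `|v i 0 - v j 0|%:~R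
    :> rat.
Proof.
move=> /mxOverP Fv; rewrite half_ratE.
  congr (_ * _); rewrite natr_sum; apply: eq_bigr => i _.
  by rewrite natr_sum; apply: eq_bigr => j _; rewrite -abszE.
rewrite even_halfK // -dvdn2.
by do 2![apply: dvdn_sum => ? _]; rewrite signF_dist // -mul2n dvdn_mulr.
Qed.

Lemma parityE (q : nat) (hq : (1 < q)%N) (v : 'cV[int]_q) :
  v \is a mxOver signF ->
  (parity hq v)%:R =
    2^-1 * `|v (first_ord hq) 0 - v (last_ord hq) 0|%:~R :> rat.
Proof.
by move=> /mxOverP Fv; rewrite half_ratE ?signF_half // -abszE.
Qed.

Lemma val_last_ord (q : nat) (hq : (1 < q)%N) : last_ord hq = q.-1 :> nat.
Proof. by rewrite /= subn1. Qed.

(* Main.v *)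
Require Import Defs.
From mathcomp Require Import all_boot all_order all_algebra.
From mathcomp Require Import zify ring.

(** The identity comes from a recursion for one Kronecker product.  Let [u] and
    [w] be sign vectors of sizes [M] and [N].  The vector [u *t w] consists of
    [M] consecutive copies of [w], the [a]-th one multiplied by [u a].  Each
    copy contributes the sign changes of [w].  Between the copies [a] and
    [a.+1] the last entry of [w], multiplied by [u a], meets the first entry of
    [w], multiplied by [u a.+1]; so there is a sign change at this junction
    exactly when one, but not both, of the following holds: [u] changes sign at
    [a], or the end entries of [w] differ.  As the exclusive or of two bits [x]
    and [y] is [y + (-1) ^+ y * x], summing over the junctions gives
    ([sequency_tens])
      S (u *t w) = M * S w + (M - 1) * p w + (-1) ^+ (p w) * S u,
    and comparing the two ends of [u *t w] gives ([parity_tens])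
      p (u *t w) = p w + (-1) ^+ (p w) * p u.

    A column of a Kronecker power is the Kronecker product of the columns of [A]
    selected by the digits of its index, the most significant digit giving the
    left-most factor.  Peeling off that digit and iterating the two recursions
    yields the formula: the parity recursion unfolds to
    [\sum_r (-1) ^+ P r * p (k r)], where [P r] is the sum of the parities of
    the digits below [r], and this is what turns the weight [q * (q ^+ m - 1)]
    of [p (k r)] into [q ^+ m.+1 - 1] at each step. *)

Import Order.TTheory GRing.Theory Num.Theory.
Local Open Scope ring_scope.

(** * Sign vectors as functions on natural numbers *)

(** Indexing by [nat] lets positions be computed by ordinary arithmetic, in
    particular the position [a * N + b] in a Kronecker product and the successor
    of a position. *)
Definition entry {N : nat} (v : 'cV[int]_N) (i : nat) : int :=
  oapp (fun j => v j 0) 0 (insub i).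

Lemma entryE {N} (v : 'cV[int]_N) (i : 'I_N) : entry v i = v i 0.
Proof. by rewrite /entry valK. Qed.

Lemma entry_sign {N} {v : 'cV[int]_N} {i} :
  v \is a mxOver signF -> (i < N)%N -> entry v i \in signF.
Proof. by move=> /mxOverP Fv ltiN; rewrite (entryE v (Ordinal ltiN)). Qed.

Lemma sequency_entry {N} (v : 'cV[int]_N.+1) : v \is a mxOver signF ->
  sequency v = (\sum_(i < N) (entry v i != entry v i.+1))%N.
Proof.
move=> Fv; rewrite /sequency big_ord_recr /= [X in (_ + X)%N]big1 ?addn0;
  last first.
  by move=> j /eqP Ej; have := ltn_ord j; rewrite Ej ltnn.
rewrite -[RHS]doubleK -mul2n big_distrr /=; congr _./2.
apply: eq_bigr => i _; have lt_iN : (i.+1 < N.+1)%N by rewrite ltnS.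
rewrite (big_pred1 (Ordinal lt_iN)) => [|j]; last by rewrite /= -val_eqE.
rewrite -!entryE /= signF_dist ?mul2n //; apply: entry_sign => //.
exact: ltnW.
Qed.

Lemma parity_entry {N} (hN : (1 < N)%N) (v : 'cV[int]_N) :
  v \is a mxOver signF -> parity hN v = (entry v N.-1 != entry v 0).
Proof.
move=> Fv; rewrite /parity -!entryE val_last_ord /= signF_dist.
- by rewrite doubleK eq_sym.
- by apply: entry_sign => //; apply: ltnW.
- by apply: entry_sign => //; lia.
Qed.

(** * Kronecker product of two sign vectors *)

Lemma tens_sign {M N} {u : 'cV[int]_M} {w : 'cV[int]_N} :
  u \is a mxOver signF -> w \is a mxOver signF ->
  (u *t w : 'cV_(M * N)) \is a mxOver signF.
Proof.
move=> /mxOverP Fu /mxOverP Fw; apply/mxOverP => i j; rewrite mxE.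
by have := Fu (mxtens_unindex i).1 0; have := Fw (mxtens_unindex i).2 0;
  rewrite !ord1 !inE => /orP[]/eqP-> /orP[]/eqP->.
Qed.

Lemma entry_tens {M N} (u : 'cV[int]_M) (w : 'cV[int]_N) {a b} :
  (a < M)%N -> (b < N)%N ->
  entry (u *t w : 'cV_(M * N)) (a * N + b) = entry u a * entry w b.
Proof.
move=> lt_aM lt_bN; pose i := Ordinal lt_aM; pose j := Ordinal lt_bN.
rewrite (entryE _ (mxtens_index (i, j))) mxE mxtens_indexK /=.
by rewrite (entryE u i) (entryE w j) !ord1.
Qed.

(** Two products of signs differ exactly when an odd number of the factors do:
    the exclusive or, in the form [y + (-1) ^+ y * x]. *)
Lemma sign_mul_neq {x y s t : int} :
  x \in signF -> y \in signF -> s \in signF -> t \in signF ->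
  (x * s != y * t)%:Z = (s != t)%:Z + (-1) ^+ (s != t) * (x != y)%:Z.
Proof.
by rewrite !inE => /orP[]/eqP-> /orP[]/eqP-> /orP[]/eqP-> /orP[]/eqP->.
Qed.

Lemma parity_tens {M N} (hM : (1 < M)%N) (hN : (1 < N)%N) (hMN : (1 < M * N)%N)
    (u : 'cV[int]_M) (w : 'cV[int]_N) :
  u \is a mxOver signF -> w \is a mxOver signF ->
  (parity hMN (u *t w))%:Z
    = (parity hN w)%:Z + (-1) ^+ parity hN w * (parity hM u)%:Z.
Proof.
move=> Fu Fw; rewrite !parity_entry ?tens_sign //.
have -> : (M * N).-1 = (M.-1 * N + N.-1)%N by nia.
have -> : entry (u *t w : 'cV_(M * N)) 0 = entry u 0 * entry w 0.
  exact: (entry_tens u w (ltnW hM) (ltnW hN)).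
rewrite entry_tens ?sign_mul_neq ?entry_sign //; lia.
Qed.

Lemma sign_parity_tens {M N} (hM : (1 < M)%N) (hN : (1 < N)%N)
    (hMN : (1 < M * N)%N) (u : 'cV[int]_M) (w : 'cV[int]_N) :
  u \is a mxOver signF -> w \is a mxOver signF ->
  (-1) ^+ parity hMN (u *t w)
    = (-1) ^+ parity hN w * (-1) ^+ parity hM u :> int.
Proof.
move=> Fu Fw; have := parity_tens hM hN hMN u w Fu Fw.
by rewrite !parity_entry ?tens_sign //; do 3![case: (_ != _)].
Qed.

(** The [M] copies of [w] account for [M * S w]; each of the [M - 1] junctions
    accounts for an exclusive or. *)
Lemma sequency_tens {M N} (hM : (0 < M)%N) (hN : (1 < N)%N)
    (u : 'cV[int]_M) (w : 'cV[int]_N) :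
  u \is a mxOver signF -> w \is a mxOver signF ->
  (sequency (u *t w : 'cV_(M * N)))%:Z
    = M%:Z * (sequency w)%:Z + (M%:Z - 1) * (parity hN w)%:Z
      + (-1) ^+ parity hN w * (sequency u)%:Z.
Proof.
case: M N => [|M] [|N] // in hM hN u w * => Fu Fw; set v := _ *t _.
have Fv : v \is a mxOver signF by apply: tens_sign.
rewrite (@sequency_entry (N + M * N.+1) v Fv) !sequency_entry //.
rewrite parity_entry //=.
set c := fun i : nat => (entry v i != entry v i.+1 : nat).
(* The last position of [v] has no successor, so [c] compares it there with the
     default value 0.  Adding this term to both sides makes the range of
     summation a union of full blocks; it cancels below as the end of the last
     block. *)
apply: (addIr (c (N + M * N.+1)%N)%:Z).
rewrite -PoszD -(big_ord_recr _ (fun i : 'I_ _ => c i)) /=.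
have -> : (\sum_(i < (N + M * N.+1).+1) c i
           = \sum_(a < M.+1) \sum_(b < N.+1) c (a * N.+1 + b))%N.
  rewrite pair_big /=.
  rewrite (reindex (@mxtens_index M.+1 N.+1)) /=; last first.
    by exists (@mxtens_unindex _ _) => i _;
      rewrite (mxtens_indexK, mxtens_unindexK).
  by apply: eq_bigr => -[].
have copy (a : 'I_M.+1) : (\sum_(b < N.+1) c (a * N.+1 + b)
    = \sum_(b < N) (entry w b != entry w b.+1) + c (a * N.+1 + N))%N.
  rewrite big_ord_recr /=; congr (_ + _)%N; apply: eq_bigr => b _.
  have lt_bN := ltn_ord b; rewrite /c -addnS.
  rewrite !entry_tens ?(ltn_ord a) ?ltnS ?(ltnW lt_bN) //.
  have /mulfI/inj_eq-> // : entry u a != 0.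
  by have := entry_sign Fu (ltn_ord a); rewrite !inE => /orP[]/eqP->.
rewrite (eq_bigr _ (fun a _ => copy a)) big_split /= sum_nat_const card_ord.
rewrite [X in (_ + X)%N]big_ord_recr /= !PoszD PoszM [(M * _ + N)%N]addnC addrA.
congr (_ + _); rewrite -[RHS]addrA; congr (_ + _).
have -> : M.+1%:Z - 1 = M%:Z by lia.
rewrite !(big_morph Posz PoszD (erefl _)) mulr_sumr.
have -> z : M%:Z * z = \sum_(a < M) z.
  by rewrite sumr_const card_ord -mulr_natl natz.
rewrite -big_split /=; apply: eq_bigr => a _; rewrite /c.
have -> : (a * N.+1 + N).+1 = (a.+1 * N.+1 + 0)%N by lia.
by rewrite !entry_tens ?sign_mul_neq ?entry_sign //; have := ltn_ord a; lia.
Qed.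

(** * Columns of Kronecker powers *)

Lemma col_tens {m n p q} (A : 'M[int]_(m, n)) (B : 'M[int]_(p, q)) a b :
  col (mxtens_index (a, b)) (A *t B) = col a A *t col b B.
Proof. by apply/matrixP => i j; rewrite !mxE mxtens_indexK. Qed.

Lemma digits_index_recr {q n} (k : 'I_n.+1 -> 'I_q) :
  cast_ord (expnS q n) (digits_index k)
    = mxtens_index (k ord_max, digits_index (k \o widen_ord (leqnSn n))).
Proof.
by apply: val_inj; rewrite /= big_ord_recr /= addnC [(q ^ n * _)%N]mulnC.
Qed.

Lemma col_ntens {q n} (A : 'M[int]_q) (k : 'I_n.+2 -> 'I_q) :
  col (digits_index k) (A ^t n.+2)
    = col (k ord_max) A
        *t col (digits_index (k \o widen_ord (leqnSn n.+1))) (A ^t n.+1).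
Proof.
rewrite -col_tens -digits_index_recr ntensmxSS; congr (col _ _).
exact: val_inj.
Qed.

Lemma col_ntens1 {q} (A : 'M[int]_q) (k : 'I_1 -> 'I_q) :
  col (digits_index k) (A ^t 1) = col (k ord0) A.
Proof.
rewrite ntensmx1; congr (col _ A); apply: val_inj.
by rewrite /= big_ord_recl big_ord0 expn0 mul1n addn0.
Qed.

Lemma col_sign {q} {A : 'M[int]_q} c :
  A \is a mxOver signF -> col c A \is a mxOver signF.
Proof.
by move=> FA; apply/mxOverP => i j; rewrite mxE; apply: (mxOverP FA).
Qed.

Lemma col_ntens_sign {q n} {A : 'M[int]_q} (k : 'I_n.+1 -> 'I_q) :
  A \is a mxOver signF -> col (digits_index k) (A ^t n.+1) \is a mxOver signF.
Proof.
move=> FA; elim: n k => [|n IHn] k; first by rewrite col_ntens1 col_sign.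
by rewrite col_ntens; exact: tens_sign (col_sign _ FA) (IHn _).
Qed.

(** * Unfolding the two recursions *)

(** The common shape of the solutions of the recursions for the parity and for
    the sequency: the sign in front of the contribution of a digit records
    whether the end entries of the product of the less significant columns
    differ. *)
Definition twisted_sum {n} (p : 'I_n -> nat) (F : 'I_n -> int) : int :=
  \sum_(r < n) (-1) ^+ (\sum_(m < n | (m < r)%N) p m)%N * F r.

Lemma twisted_sum_recr {n} (p : 'I_n.+1 -> nat) (F : 'I_n.+1 -> int) :
  twisted_sum p F
    = twisted_sum (p \o widen_ord (leqnSn n)) (F \o widen_ord (leqnSn n))
      + (-1) ^+ (\sum_(m < n) p (widen_ord (leqnSn n) m))%N * F ord_max.
Proof.
rewrite /twisted_sum big_ord_recr /=; congr (_ + _ ^+ _ * _).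
  apply: eq_bigr => r _; congr (_ ^+ _ * _).
  by rewrite big_mkcond big_ord_recr /= ltnNge ltnW //= addn0 -big_mkcond.
rewrite big_mkcond big_ord_recr /= ltnn addn0.
by apply: eq_bigr => m _; rewrite ltn_ord.
Qed.

Lemma twisted_sum1 (p : 'I_1 -> nat) (F : 'I_1 -> int) :
  twisted_sum p F = F ord0.
Proof.
by rewrite /twisted_sum big_ord1 big1 ?expr0 ?mul1r.
Qed.

Section ColumnsOfPower.

Variables (q : nat) (hq : (1 < q)%N) (A : 'M[int]_q).
Hypothesis FA : A \is a mxOver signF.

Let p (c : 'I_q) : nat := parity hq (col c A).
Let Sq (c : 'I_q) : nat := sequency (col c A).

Let power_gt1 n : (1 < q ^ n.+1)%N.
Proof. by rewrite -(exp1n n.+1) ltn_exp2r. Qed.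

Let parity_irrel N (h h' : (1 < N)%N) v : parity h v = parity h' v.
Proof. by rewrite (bool_irrelevance h h'). Qed.

Lemma sign_parity_ntens n (k : 'I_n.+1 -> 'I_q) :
  (-1) ^+ parity (power_gt1 n) (col (digits_index k) (A ^t n.+1))
    = (-1) ^+ (\sum_(m < n.+1) p (k m))%N :> int.
Proof.
elim: n k => [|n IHn] k.
  by rewrite col_ntens1 (parity_irrel _ _ hq) big_ord1.
rewrite col_ntens (sign_parity_tens hq (power_gt1 n)) ?(col_sign _ FA) //;
  last exact: col_ntens_sign.
by rewrite IHn -exprD [in RHS]big_ord_recr.
Qed.

Lemma parity_ntens n (k : 'I_n.+1 -> 'I_q) :
  (parity (power_gt1 n) (col (digits_index k) (A ^t n.+1)))%:Z
    = twisted_sum (p \o k) (fun r => (p (k r))%:Z).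
Proof.
elim: n k => [|n IHn] k.
  by rewrite col_ntens1 (parity_irrel _ _ hq) twisted_sum1.
rewrite col_ntens (parity_tens hq (power_gt1 n)) ?(col_sign _ FA) //;
  last exact: col_ntens_sign.
by rewrite sign_parity_ntens IHn [in RHS]twisted_sum_recr.
Qed.

Lemma sequency_ntens n (k : 'I_n.+1 -> 'I_q) :
  (sequency (col (digits_index k) (A ^t n.+1)))%:Z
    = twisted_sum (p \o k) (fun r => q%:Z ^+ (n - r) * (Sq (k r))%:Z
                                     + (q%:Z ^+ (n - r) - 1) * (p (k r))%:Z).
Proof.
elim: n k => [|n IHn] k.
  by rewrite col_ntens1 twisted_sum1 expr0 mul1r subrr mul0r addr0.
rewrite col_ntens (sequency_tens (ltnW hq) (power_gt1 n)) ?(col_sign _ FA) //;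
  last exact: col_ntens_sign.
rewrite sign_parity_ntens parity_ntens IHn [in RHS]twisted_sum_recr.
rewrite subnn expr0 mul1r subrr mul0r addr0; congr (_ + _).
rewrite /twisted_sum !mulr_sumr -big_split /=; apply: eq_bigr => r _.
(* The parity terms add up as q * (q ^+ m - 1) + (q - 1) = q ^+ m.+1 - 1. *)
by rewrite subSn ?leq_ord // exprS; ring.
Qed.

End ColumnsOfPower.

Theorem theorem3p6 (q n : nat) (hq : (1 < q)%N) (hn : (1 < n)%N)
    (A : 'M[int]_q) (hA : A \is a mxOver signF) (k : 'I_n -> 'I_q) :
  let Sq (c : 'I_q) : nat := sequency (col c A) in
  let p (c : 'I_q) : nat := parity hq (col c A) in
  (sequency (col (digits_index k) (A ^t n)))%:Z =
    \sum_(r < n) (-1) ^+ (\sum_(m < n | (m < r)%N) p (k m))%N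
      * ((q%:Z ^+ (n - 1 - r)) * (Sq (k r))%:Z
         + (q%:Z ^+ (n - 1 - r) - 1) * (p (k r))%:Z).
Proof.
case: n hn k => [//|n] _ k Sq p; rewrite (@sequency_ntens _ hq _ hA).
by apply: eq_bigr => r _; rewrite !subn1.
Qed.
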